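(* (Switching regret.) Let $d\ge1$, $G>0$, and run the anytime Haar OLR algorithm described in the context. Then for all $T\in\mathbb{N}_+$ and all comparators $u_{1:T}=(u_1,\ldots,u_T)\in(\mathbb{R}^d)^T$, $$\mathrm{Reg}_T(u_{1:T})\le \tilde O\Big(\|\bar u\|_2\sqrt T+\sqrt{K\bar E}\Big),$$ where $\bar u=\frac1T\sum_{t=1}^T u_t$, $K=\sum_{t=1}^{T-1}\mathbf{1}[u_{t+1}\ne u_t]$, $\bar E=\sum_{t=1}^T\|u_t-\bar u\|_2^2$, and $\tilde O$ hides constant factors (possibly depending on $G$) and factors poly-logarithmic in $T$ and $\max_t\|u_t\|_2$.
   Context: Online convex optimization game: in each round $t$ the player picks $x_t\in\mathbb{R}^d$; an adversarial environment reveals a convex, $G$-Lipschitz (w.r.t. $\|\cdot\|_2$) loss $l_t$, possibly depending on $x_1,\ldots,x_t$; the player observes $g_t\in\partial l_t(x_t)$. Unconstrained dynamic regret: $\mathrm{Reg}_T(u_{1:T})=\sup_{\text{environments}}[\sum_{t=1}^T l_t(x_t)-\sum_{t=1}^T l_t(u_t)]$. Haar dictionary for horizon $T=2^m$: for scale $j\in[1:m]$ and location $l\in[1:2^{-j}T]$, $h^{(j,l)}\in\mathbb{R}^T$ has $t$-th entry $1$ for $t\in[2^j(l-1)+1:2^j(l-1)+2^{j-1}]$, $-1$ for $t\in[2^j(l-1)+2^{j-1}+1:2^jl]$, and $0$ otherwise; together with the all-one vector $h^*$ these $N=T$ vectors form the columns of a $T\times T$ matrix; write its $t$-th row as $(h_{t,1},\ldots,h_{t,N})$,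 $h_{t,n}\in\mathbb{R}$. FreeGrad (dimension $d$, hyperparameter $\varepsilon'>0$, Lipschitz constant $\hat G=G$): initialize $s=0\in\mathbb{R}^d$, $v=\hat G^2$; each round predict $\hat x=-\varepsilon' s\cdot\frac{(2v+\hat G\|s\|_2)\hat G^2}{2(v+\hat G\|s\|_2)^2\sqrt v}\exp\!\big(\frac{\|s\|_2^2}{2v+2\hat G\|s\|_2}\big)$, then observe $\hat g$ and update $s\leftarrow s+\hat g$, $v\leftarrow v+\|\hat g\|_2^2$. Fixed-horizon Haar OLR (horizon $T=2^m$, hyperparameter $\varepsilon$): run $N=T$ copies $\mathcal{A}_n$ of $d$-dimensional FreeGrad with hyperparameter $\varepsilon/N$. In round $t$: for each $n$ with $h_{t,n}\ne0$ query $\mathcal{A}_n$ for $\hat x_{t,n}\in\mathbb{R}^d$ (otherwise arbitrary), set $w_{t,n}=h_{t,n}\hat x_{t,n}$, predict $x_t=\sum_n w_{t,n}$; after receiving $g_t$, for each $n$ with $h_{t,n}\ne0$ send $h_{t,n}g_t$ to $\mathcal{A}_n$. Anytime Haar OLR: for $m=1,2,\ldots$, run a fresh copy of fixed-horizon Haar OLR with horizon $2^m$ and $\varepsilon=1$ for $2^m$ rounds.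
   Formalization: The bound is proved with an additive constant 1 beside ‖ū‖√T + √(KĒ) inside Õ, since for u = 0 that expression vanishes while the algorithm's regret can be a positive constant. *)

(* Defs.v *)
From HB Require Import structures.
From mathcomp Require Import all_boot all_order all_algebra.
From mathcomp Require Import reals.
From mathcomp Require Import sequences (* for analysis exp *).
From mathcomp.analysis Require Import exp.
Set Implicit Arguments. Unset Strict Implicit. Unset Printing Implicit Defensive.
Import Order.TTheory GRing.Theory Num.Theory.
Local Open Scope ring_scope.

Section Defs.
Variables (R : realType) (d : nat).
Notation vec := 'rV[R]_d.

Definition vnorm (v : vec) : R := Num.sqrt (\sum_(i < d) v 0 i ^+ 2).
Definition vdot (a b : vec) : R := \sum_(i < d) a 0 i * b 0 i.

Definition convexf (l : vec -> R) : Prop :=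
  forall (a b : vec) (lam : R), 0 <= lam -> lam <= 1 ->
    l (lam *: a + (1 - lam) *: b) <= lam * l a + (1 - lam) * l b.
Definition lipschitzf (G : R) (l : vec -> R) : Prop :=
  forall a b : vec, `|l a - l b| <= G * vnorm (a - b).
Definition subgrad (l : vec -> R) (x g : vec) : Prop :=
  forall y : vec, l x + vdot g (y - x) <= l y.

Definition freegrad_pred (eps' Gh : R) (s : vec) (v : R) : vec :=
  (- eps' * ((2 * v + Gh * vnorm s) * Gh ^+ 2)
     / (2 * (v + Gh * vnorm s) ^+ 2 * Num.sqrt v)
     * expR (vnorm s ^+ 2 / (2 * v + 2 * Gh * vnorm s))) *: s.

(* Haar dictionary for horizon 2^m.  Columns: None = h^* (all ones),
   Some (j, l) = h^(j,l).  Rows indexed by 1-based t. *)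
Definition haar (c : option (nat * nat)) (t : nat) : R :=
  match c with
  | None => 1
  | Some (j, l) =>
      if (2 ^ j * (l - 1) < t <= 2 ^ j * (l - 1) + 2 ^ j.-1)%N then 1
      else if (2 ^ j * (l - 1) + 2 ^ j.-1 < t <= 2 ^ j * l)%N then -1
      else 0
  end.

Definition haar_cols (m : nat) : seq (option (nat * nat)) :=
  None :: [seq Some (j, l) | j <- iota 1 m, l <- iota 1 (2 ^ (m - j))].

(* Anytime Haar OLR.  Rounds are 0-based globally; epoch m >= 1 covers
   global rounds 2^m - 2, ..., 2^(m+1) - 3 and runs fixed-horizon Haar OLR
   with horizon 2^m, eps = 1, i.e. N = 2^m FreeGrad copies with eps' = 1/2^m.
   [anytime_haar G gs] is the prediction x_{s} given the gradients gs of all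
   previous global rounds (size gs = s). *)
Definition anytime_haar (G : R) (gs : seq vec) : vec :=
  let s := size gs in
  let m := trunc_log 2 s.+2 in
  let st := (2 ^ m - 2)%N in
  let t := (s - st)%N in                      (* 0-based local round *)
  let g tau := nth 0 gs (st + tau) in
  let eps' := 1 / (2 ^ m)%:R in
  \sum_(c <- haar_cols m)
     haar c t.+1 *:
       freegrad_pred eps' G
         (\sum_(tau < t) haar c tau.+1 *: g tau)
         (G ^+ 2 + \sum_(tau < t) haar c tau.+1 ^+ 2 * vnorm (g tau) ^+ 2).

(* Environment: given the player's plays x_1..x_t, reveals (l_t, g_t). *)
Definition environment := seq vec -> (vec -> R) * vec.

Fixpoint history (G : R) (env : environment) (n : nat) : seq vec * seq vec :=
  match n with
  | 0 => ([::], [::])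
  | n'.+1 =>
      let h := history G env n' in
      let x := anytime_haar G h.2 in
      (rcons h.1 x, rcons h.2 (env (rcons h.1 x)).2)
  end.

(* quantities of round t (0-based) *)
Definition play G env t : vec := last 0 (history G env t.+1).1.
Definition loss G env t : vec -> R := (env (history G env t.+1).1).1.
Definition grad G env t : vec := (env (history G env t.+1).1).2.

Definition admissible (G : R) (env : environment) (T : nat) : Prop :=
  forall t, (t < T)%N ->
    [/\ convexf (loss G env t), lipschitzf G (loss G env t)
      & subgrad (loss G env t) (play G env t) (grad G env t)].

Definition regret (G : R) (env : environment) (u : nat -> vec) (T : nat) : R :=
  \sum_(t < T) (loss G env t (play G env t) - loss G env t (u t)).

Definition ubar (u : nat -> vec) (T : nat) : vec :=
  (T%:R)^-1 *: \sum_(t < T) u t.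
Definition switches (u : nat -> vec) (T : nat) : nat :=
  \sum_(t < T.-1) (u t.+1 != u t).
Definition Ebar (u : nat -> vec) (T : nat) : R :=
  \sum_(t < T) vnorm (u t - ubar u T) ^+ 2.
Definition umax (u : nat -> vec) (T : nat) : R :=
  \big[Num.max/0]_(t < T) vnorm (u t).

End Defs.

(* Main.v *)
Require Import Defs.
From HB Require Import structures.
From mathcomp Require Import all_boot all_order all_algebra.
From mathcomp Require Import zify ring lra.
From mathcomp Require Import boolp functions reals.
From mathcomp Require Import interval_inference normedtype.
From mathcomp Require Import sequences derive.
From mathcomp.analysis Require Import exp.
Set Implicit Arguments.
Unset Strict Implicit.
Unset Printing Implicit Defensive.
Import Order.TTheory GRing.Theory Num.Theory.
Import numFieldNormedType.Exports.
Local Open Scope ring_scope.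

(* Every FreeGrad copy plays minus the gradient of the potential
   [eps G^2 v^(-1/2) exp (|s|^2 / (2 v + 2 G |s|))], and one round never
   increases potential plus accumulated loss; comparing the potential with
   [|u| |s|] bounds the regret of a copy against a fixed [u] by
   [eps G + O(L |u| sqrt v)] with [L] logarithmic.

   In an epoch of length [2^m] the comparator is expanded in the Haar
   dictionary by telescoping its dyadic averages.  A coefficient at scale [j]
   vanishes unless the comparator switches near its block, and by
   Cauchy-Schwarz it is at most [sqrt (E_block / 2^j)], where [E_block] is the
   squared deviation from any fixed vector, here the global mean.  Hence each
   scale contributes at most [sqrt ((K + 1) E)], and there are only
   logarithmically many scales and epochs.  The unfinished last epoch is
   handled by continuing the comparator with its mean; the extra switch is
   harmless because [K = 0] forces [E = 0]. *)

(** * Exponential inequalities *)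

Lemma is_derive_ge0_le (R : realType) (f df : R -> R) (x : R) :
  (forall y : R, is_derive y (1 : R) f (df y)) ->
  (forall y, 0 <= y -> 0 <= df y) -> 0 <= x -> f 0 <= f x.
Proof.
move=> fD df0; rewrite le_eqVlt => /predU1P[<-//|x0].
have [|c] := @MVT R f df 0 x x0 (fun y _ => fD y).
  by apply: derivable_within_continuous => y _.
rewrite in_itv/= subr0 => /andP[c0 _] fE.
by rewrite -subr_ge0 fE mulr_ge0 ?df0 // ltW.
Qed.

Lemma expRN_le (R : realType) (y : R) :
  0 <= y -> expR (- y) <= 1 - y + y ^+ 2 / 2.
Proof.
move=> y0; rewrite expRN -div1r ler_pdivrMr ?expR_gt0//.
(* After multiplication by [2 * expR y] the claim reads [2 <= f y], and the derivative of [f] is a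
   square times [expR]. *)
pose f : R -> R := fun z => (1 + (1 - z) * (1 - z)) * expR z.
pose df : R -> R := fun z => z ^+ 2 * expR z.
have f0 : f 0 = 2 by rewrite /f expR0; ring.
suff : f 0 <= f y by rewrite f0 /f; lra.
apply: (@is_derive_ge0_le R f df) => // [z|z z0]; last first.
  by rewrite /df mulr_ge0 ?expR_ge0// sqr_ge0.
have -> : f = (cst 1 + (cst 1 - id) * (cst 1 - id)) * (@expR R).
  by apply/funext => t; rewrite /f !fctE.
apply: is_derive_eq.
by rewrite /df !fctE/= /GRing.scale/=; ring.
Qed.

(** This is the Pade bound [2 * x / (2 + x) <= ln (1 + x)]. With [z = x / (2 + x)] it takes the
    symmetric form [expR z * (1 - z) <= expR (- z) * (1 + z)], which follows by differentiation. *)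
Lemma expR_le_1D (R : realType) (x : R) :
  0 <= x -> expR (2 * x / (2 + x)) <= 1 + x.
Proof.
move=> x0; set z := x / (2 + x).
have z0 : 0 <= z by rewrite divr_ge0// addr_ge0.
have z1 : z < 1 by rewrite /z ltr_pdivrMr; lra.
have -> : 2 * x / (2 + x) = z + z by rewrite /z; field; lra.
have -> : 1 + x = (1 + z) / (1 - z).
  have h : x * (2 + x)^-1 * (2 + x) = x by rewrite mulfVK//; lra.
  rewrite /z; field; lra.
rewrite ler_pdivlMr ?subr_gt0// expRD -mulrA.
rewrite -ler_pdivlMl ?expR_gt0// -expRN.
pose f : R -> R := fun t => expR (- t) * (1 + t) - expR t * (1 - t).
pose df : R -> R := fun t => t * (expR t - expR (- t)).
rewrite -subr_ge0 -/(f z).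
have f0 : f 0 = 0 by rewrite /f oppr0 expR0; ring.
rewrite -f0.
apply: (@is_derive_ge0_le R f df) => // [t|t t0]; last first.
  by rewrite /df mulr_ge0// subr_ge0 ler_expR; lra.
have -> : f = ((@expR R) \o (- id)) * (cst 1 + id) - (@expR R) * (cst 1 - id).
  by apply/funext => s; rewrite /f !fctE.
apply: is_derive_eq.
rewrite /df !fctE/= /GRing.scale/=; ring.
Qed.

(* With [theta = s / (v + s)], [theta - theta ^+ 2 / 2] is the norm of the
   gradient of [s ^+ 2 / (2 * (v + s))]. *)
Lemma expR_le_1D_quad (R : realType) (theta g : R) :
  0 <= theta <= 1 -> -1 <= g <= 1 ->
  expR (g * (theta - theta ^+ 2 / 2) - g ^+ 2 * theta ^+ 2 / 2)
    <= 1 + g * (theta - theta ^+ 2 / 2).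
Proof.
move=> /andP[t0 t1] /andP[g0 g1]; set x := theta - _.
have x0 : 0 <= x by rewrite /x; nra.
have xt : x <= theta by rewrite /x; nra.
have [gp|gn] := leP 0 g.
  set z := g * x; have z0 : 0 <= z by rewrite mulr_ge0.
  apply: le_trans (expR_le_1D z0); rewrite ler_expR ler_pdivlMr; last lra.
  have zt : z ^+ 2 <= g ^+ 2 * theta ^+ 2.
    by rewrite -exprMn ler_pXn2r// ?nnegrE ?mulr_ge0// ler_wpM2l.
  nra.
(* For negative [g] the exponent is [- y] with [0 <= y <= - g * theta]. Replacing [y ^+ 2] by
   [(g * theta) ^+ 2] in the quadratic bound on [expR (- y)] gives exactly the right-hand side. *)
set y := - g * theta - (- g) * (1 + g) * theta ^+ 2 / 2.
have y0 : 0 <= y.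
  have -> : y = - g * (theta * (1 - (1 + g) * theta / 2)) by rewrite /y; ring.
  rewrite mulr_ge0//; [lra|]; rewrite mulr_ge0//; nra.
have yt : y <= - g * theta.
  rewrite /y gerBl divr_ge0// mulr_ge0// ?sqr_ge0// mulr_ge0//; lra.
have -> : g * x - g ^+ 2 * theta ^+ 2 / 2 = - y by rewrite /x /y; ring.
apply: le_trans (expRN_le y0) _.
have -> : 1 + g * x = 1 - y + (- g * theta) ^+ 2 / 2 by rewrite /x /y; ring.
rewrite lerD2l ler_wpM2r// ler_pXn2r// nnegrE//; exact: le_trans yt.
Qed.

(** * The FreeGrad potential *)

(** This numerator is left over in [fg_exponent_step] when the step [g = - p] overshoots the origin.
    Only [s < p ^+ 2] is delicate; there [s = k * p ^+ 2] makes [p ^+ 4] a common factor. *)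
Lemma fg_cubic_bound (R : realType) (v s p : R) :
  1 <= v -> 0 <= s -> 0 <= p <= 1 -> s < p ->
  0 <= p ^+ 4 * (v + s) + s * (2 * p - s) * (s - p ^+ 2) * (2 * v + p ^+ 2).
Proof.
move=> v1 s0 /andP[p0 p1] sp.
have [ps|ps] := leP (p ^+ 2) s.
  have v0 : 0 <= v by lra.
  have b0 : 0 <= 2 * p - s by lra.
  have c0 : 0 <= s - p ^+ 2 by lra.
  by rewrite addr_ge0// !mulr_ge0// ?addr_ge0// ?mulr_ge0// exprn_ge0.
have pp : 0 < p by apply: le_lt_trans sp.
have p2 : 0 < p ^+ 2 by rewrite exprn_gt0.
have p21 : p ^+ 2 <= 1 by rewrite expr_le1.
set k := s / p ^+ 2.
have sE : s = k * p ^+ 2 by rewrite /k mulfVK// gt_eqF.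
have k0 : 0 <= k by rewrite divr_ge0// ltW.
have k1 : k <= 1 by rewrite /k ler_pdivrMr// mul1r ltW.
have -> : p ^+ 4 * (v + s) + s * (2 * p - s) * (s - p ^+ 2) * (2 * v + p ^+ 2) =
  p ^+ 4 * (v + k * p ^+ 2 - k * (1 - k) * (p * (2 - k * p)) * (2 * v + p ^+ 2)).
  by rewrite sE; ring.
rewrite mulr_ge0 ?exprn_ge0// subr_ge0.
have mono : p * (2 - k * p) <= 2 - k by nra.
have kk : 0 <= k * (1 - k) by nra.
have vp : 0 <= 2 * v + p ^+ 2 by lra.
apply: (@le_trans _ _ (k * (1 - k) * (2 - k) * (2 * v + p ^+ 2))).
  by rewrite ler_wpM2r// ler_wpM2l.
set k3 := k * (1 - k) * (2 - k).
(* Split [v] as [(v - p ^+ 2) + p ^+ 2]: the first part needs [2 * k3 <= 1], the second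
   [3 * k3 <= 1 + k]. *)
have k31 : 2 * k3 <= 1.
  have : 0 <= (1 - 2 * k) ^+ 2 + 2 * k ^+ 2 * (1 - k).
    rewrite addr_ge0 ?sqr_ge0// mulr_ge0 ?subr_ge0// mulr_ge0// sqr_ge0//.
  by rewrite /k3; lra.
have k32 : 3 * k3 <= 1 + k.
  have : 0 <= 2 * k ^+ 3 + (1 - k) * ((1 - 2 * k) ^+ 2 + k ^+ 2).
    apply: addr_ge0; apply: mulr_ge0 => //; rewrite ?exprn_ge0 ?subr_ge0//.
    by rewrite addr_ge0 ?sqr_ge0.
  by rewrite /k3; lra.
nra.
Qed.

(* When [s + g >= 0], the left-hand side minus the right-hand side without
   [g ^+ 2 / (2 * v + g ^+ 2)] is exactly
   [g ^+ 2 * (v - s * g) ^+ 2 / (2 * (v + s) ^+ 2 * (v + g ^+ 2 + s + g))]. *)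
Lemma fg_exponent_step (R : realType) (v s g theta : R) :
  1 <= v -> 0 <= s -> -1 <= g <= 1 -> theta = s / (v + s) ->
  `|s + g| ^+ 2 / (2 * (v + g ^+ 2 + `|s + g|)) <=
    s ^+ 2 / (2 * (v + s)) + g ^+ 2 / (2 * v + g ^+ 2)
    + (g * (theta - theta ^+ 2 / 2) - g ^+ 2 * theta ^+ 2 / 2).
Proof.
move=> v1 s0 /andP[g0 g1] thetaE.
have g2 : 0 <= g ^+ 2 by exact: sqr_ge0.
have D0 : 0 < v + s by lra.
have F0 : 0 < 2 * v + g ^+ 2 by lra.
have V0 : 0 < v + g ^+ 2 by lra.
have [sg|sg] := leP 0 (s + g).
  have E0 : 0 < v + g ^+ 2 + (s + g) by lra.
  rewrite ger0_norm//.
  have -> : (s + g) ^+ 2 / (2 * (v + g ^+ 2 + (s + g))) =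
    s ^+ 2 / (2 * (v + s)) +
    g ^+ 2 * (((v - s * g) / (v + s)) ^+ 2 / (2 * (v + g ^+ 2 + (s + g))))
    + (g * (theta - theta ^+ 2 / 2) - g ^+ 2 * theta ^+ 2 / 2).
    by rewrite thetaE; field; lra.
  rewrite lerD2r lerD2l ler_wpM2l//.
  apply: (@le_trans _ _ (2 * (v + g ^+ 2 + (s + g)))^-1); last first.
    by rewrite lef_pV2 ?posrE; lra.
  rewrite ler_piMl ?invr_ge0//; first lra.
  rewrite -[leRHS](expr1n _ 2) -(@real_normK _ (_ / _)) ?num_real//.
  rewrite ler_pXn2r ?nnegrE// normrM normfV ler_pdivrMr ?normr_gt0; last lra.
  rewrite mul1r [leRHS]gtr0_norm// ler_norml; apply/andP; split; nra.
(* The sum crosses the origin. Even after [p - s] is dropped from the denominator, the gap to the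
   right-hand side is the numerator of [fg_cubic_bound] over a positive denominator, plus a
   nonnegative term. *)
rewrite ltr0_norm//.
have [p pE] : exists p, g = - p by exists (- g); rewrite opprK.
have p0 : 0 < p by lra.
have p1 : p <= 1 by lra.
have sp : s < p by lra.
rewrite pE !sqrrN in g2 F0 V0 *.
apply: (@le_trans _ _ ((p - s) ^+ 2 / (2 * (v + p ^+ 2)))).
  have -> : (s - p) ^+ 2 = (p - s) ^+ 2 by ring.
  rewrite ler_wpM2l ?sqr_ge0// lef_pV2 ?posrE; lra.
rewrite -subr_ge0.
set rhs := (X in 0 <= X).
have -> : rhs = (p ^+ 4 * (v + s) + s * (2 * p - s) * (s - p ^+ 2) * (2 * v + p ^+ 2))
     / (2 * (v + p ^+ 2) * (2 * v + p ^+ 2) * (v + s)) +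
     p * (1 - p) * s ^+ 2 / (2 * (v + s) ^+ 2).
  by rewrite /rhs thetaE; field; lra.
rewrite addr_ge0// divr_ge0//.
- by apply: fg_cubic_bound => //; rewrite ltW.
- by rewrite !mulr_ge0//; lra.
- by rewrite !mulr_ge0 ?sqr_ge0//; lra.
- by rewrite mulr_ge0// sqr_ge0.
Qed.

(* The FreeGrad potential for [G = 1]; the general case follows by scaling. *)
Definition unit_potential (R : realType) (v s : R) : R :=
  expR (s ^+ 2 / (2 * (v + s))) / Num.sqrt v.

(** The summands of [fg_exponent_step] become three factors: the old exponential, one paid for by
    the growth of [Num.sqrt v] (by [expR_le_1D] at [g ^+ 2 / v]), and one turned into the linear
    term by [expR_le_1D_quad]. *)
Lemma unit_potential_step_colinear (R : realType) (v s g : R) :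
  1 <= v -> 0 <= s -> -1 <= g <= 1 ->
  unit_potential (v + g ^+ 2) `|s + g| <=
  unit_potential v s * (1 + (2 * v + s) / (2 * (v + s) ^+ 2) * (s * g)).
Proof.
move=> v1 s0 gb; have g2 : 0 <= g ^+ 2 by exact: sqr_ge0.
rewrite /unit_potential ler_pdivrMr ?sqrtr_gt0; last lra.
set theta := s / (v + s).
have tb : 0 <= theta <= 1.
  by rewrite /theta divr_ge0 ?ler_pdivrMr ?mul1r//=; lra.
have -> : (2 * v + s) / (2 * (v + s) ^+ 2) * (s * g) = g * (theta - theta ^+ 2 / 2).
  by rewrite /theta; field; lra.
have := fg_exponent_step v1 s0 gb (erefl theta); rewrite -ler_expR => /le_trans; apply.
set rhs := (X in _ <= X).
have -> : rhs = expR (s ^+ 2 / (2 * (v + s))) * ((Num.sqrt v)^-1 * Num.sqrt (v + g ^+ 2))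
   * (1 + g * (theta - theta ^+ 2 / 2)) by rewrite /rhs; ring.
rewrite 2!expRD ler_pM ?expR_ge0 ?mulr_ge0 ?expR_ge0 ?expR_le_1D_quad//.
rewrite ler_wpM2l ?expR_ge0//.
rewrite ler_pdivlMl ?sqrtr_gt0; last lra.
rewrite -(ger0_norm (expR_ge0 (_ / _))) -sqrtr_sqr -sqrtrM; last lra.
rewrite ler_sqrt; last lra.
have -> : v + g ^+ 2 = v * (1 + g ^+ 2 / v) by field; lra.
apply: ler_wpM2l; first lra.
have x0 : 0 <= g ^+ 2 / v by rewrite divr_ge0//; lra.
apply: le_trans (expR_le_1D x0); rewrite -expRM_natl ler_expR.
by rewrite le_eqVlt; apply/orP; left; apply/eqP; field; lra.
Qed.

(* The component of the gradient orthogonal to the current sum only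
   decreases the potential, which reduces the step to the colinear case. *)
Lemma unit_potential_step (R : realType) (v s r w c : R) :
  1 <= v -> 0 <= s -> 0 <= r -> w <= 1 ->
  r ^+ 2 = s ^+ 2 + 2 * c + w -> c ^+ 2 <= s ^+ 2 * w ->
  unit_potential (v + w) r <=
  unit_potential v s * (1 + (2 * v + s) / (2 * (v + s) ^+ 2) * c).
Proof.
move=> v1 s0 r0 w1 rE cs.
(* [g] is the signed component of the increment along the current sum. If [s = 0] then [c = 0], and
   the convention [c / 0 = 0] gives a valid [g]. *)
have [g cE gw] : exists2 g, c = s * g & g ^+ 2 <= w.
  exists (c / s).
    have [s00|sn0] := eqVneq s 0; last by field.
    by move: cs; rewrite s00 expr0n mul0r mul0r => cs; nra.
  have [s00|sn0] := eqVneq s 0.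
    by rewrite s00 invr0 mulr0 expr0n/=; move: rE cs; rewrite s00 => rE cs; nra.
  rewrite expr_div_n ler_pdivrMr ?exprn_gt0 ?lt_def ?sn0// mulrC//.
have gb : -1 <= g <= 1 by apply/andP; split; nra.
rewrite cE; apply: le_trans (unit_potential_step_colinear v1 s0 gb).
set r1 := `|s + g|; have r10 : 0 <= r1 by rewrite normr_ge0.
have r1E : r1 ^+ 2 = s ^+ 2 + 2 * c + g ^+ 2.
  by rewrite real_normK ?num_real// cE; ring.
have rr : r1 <= r by rewrite -(ler_pXn2r (n := 2))// rE r1E; lra.
have g2 : 0 <= g ^+ 2 by exact: sqr_ge0.
have V0 : 0 < v + w by lra.
have V1 : 0 < v + g ^+ 2 by lra.
have exple : r ^+ 2 / (2 * (v + w + r)) <=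
    r1 ^+ 2 / (2 * (v + g ^+ 2 + r1)) + (w - g ^+ 2) / (2 * (v + w)).
  have -> : r ^+ 2 = r1 ^+ 2 + (w - g ^+ 2) by rewrite rE r1E; ring.
  rewrite mulrDl lerD// ler_wpM2l ?sqr_ge0 ?subr_ge0// lef_pV2 ?posrE; lra.
rewrite /unit_potential ler_pdivrMr ?sqrtr_gt0//.
move: exple; rewrite -ler_expR => /le_trans; apply.
rewrite expRD -[leRHS]mulrA ler_wpM2l ?expR_ge0// ler_pdivlMl ?sqrtr_gt0//.
rewrite -(ger0_norm (expR_ge0 (_ / _))) -sqrtr_sqr -sqrtrM; last lra.
rewrite ler_sqrt; last lra.
rewrite -expRM_natl -ler_pdivlMr ?expR_gt0// -expRN.
(* By [1 - z <= expR (- z)] at [z = (w - g ^+ 2) / (v + w)], the larger square root in the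
   denominator pays for the orthogonal component. *)
have /(ler_wpM2l (ltW V0)) := expR_ge1Dx (- (2%:R * ((w - g ^+ 2) / (2 * (v + w))))).
apply: le_trans.
by rewrite le_eqVlt; apply/orP; left; apply/eqP; field; lra.
Qed.

(** * Cauchy-Schwarz and Euclidean norms *)

Lemma cauchy_schwarz_sum (R : realType) (I : Type) (r : seq I) (a b : I -> R) :
  (\sum_(i <- r) a i * b i) ^+ 2 <=
  (\sum_(i <- r) a i ^+ 2) * (\sum_(i <- r) b i ^+ 2).
Proof.
elim: r => [|i r IH]; first by rewrite !big_nil expr0n mul0r.
rewrite !big_cons; set A := \sum_(j <- r) a j ^+ 2 in IH *.
set B := \sum_(j <- r) b j ^+ 2 in IH *.
set C := \sum_(j <- r) a j * b j in IH *.
have A0 : 0 <= A by apply: sumr_ge0 => j _; exact: sqr_ge0.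
have B0 : 0 <= B by apply: sumr_ge0 => j _; exact: sqr_ge0.
have key : 2 * (C * (a i * b i)) <= A * b i ^+ 2 + a i ^+ 2 * B.
  have rhs0 : 0 <= A * b i ^+ 2 + a i ^+ 2 * B.
    by rewrite addr_ge0// mulr_ge0// sqr_ge0.
  have [neg|pos] := leP (2 * (C * (a i * b i))) 0; first exact: le_trans rhs0.
  rewrite -(ler_pXn2r (n := 2)) ?nnegrE ?(ltW pos)//.
  apply: (@le_trans _ _ (4 * (A * B) * (a i * b i) ^+ 2)).
    rewrite exprMn exprMn mulrA ler_wpM2r ?sqr_ge0//.
    rewrite (_ : (2 : R) ^+ 2 = 4); last by ring.
    by rewrite ler_wpM2l.
  rewrite -subr_ge0.
  have -> : (A * b i ^+ 2 + a i ^+ 2 * B) ^+ 2 - 4 * (A * B) * (a i * b i) ^+ 2 =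
    (A * b i ^+ 2 - a i ^+ 2 * B) ^+ 2 by ring.
  exact: sqr_ge0.
lra.
Qed.

(** Merges the bounds obtained on the disjoint blocks of one Haar scale. *)
Lemma sum_sqrtM_le (R : realType) (I : Type) (r : seq I) (a b : I -> R) :
  (forall i, 0 <= a i) -> (forall i, 0 <= b i) ->
  \sum_(i <- r) Num.sqrt (a i * b i) <=
  Num.sqrt ((\sum_(i <- r) a i) * (\sum_(i <- r) b i)).
Proof.
move=> a0 b0.
have s0 : 0 <= \sum_(i <- r) Num.sqrt (a i * b i).
  by apply: sumr_ge0 => i _; exact: sqrtr_ge0.
rewrite -[leLHS]ger0_norm// -sqrtr_sqr ler_wsqrtr//.
under eq_bigr do rewrite sqrtrM//.
apply: le_trans (cauchy_schwarz_sum _ _ _) _.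
under eq_bigr do rewrite sqr_sqrtr//.
by under [X in _ * X <= _]eq_bigr do rewrite sqr_sqrtr//.
Qed.

Section Euclidean.
Variables (R : realType) (d : nat).
Implicit Types a b c x y z g u : 'rV[R]_d.

Lemma vnorm_ge0 a : 0 <= vnorm a.
Proof. exact: sqrtr_ge0. Qed.

Lemma sqr_vnorm a : vnorm a ^+ 2 = vdot a a.
Proof.
by rewrite /vnorm sqr_sqrtr// sumr_ge0// => i _; exact: sqr_ge0.
Qed.

Lemma vdotC a b : vdot a b = vdot b a.
Proof. by apply: eq_bigr => i _; rewrite mulrC. Qed.

Lemma vdotDr a b c : vdot a (b + c) = vdot a b + vdot a c.
Proof. by rewrite /vdot -big_split/=; apply: eq_bigr => i _; rewrite mxE mulrDr. Qed.

Lemma vdotDl a b c : vdot (a + b) c = vdot a c + vdot b c.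
Proof. by rewrite vdotC vdotDr !(vdotC c). Qed.

Lemma vdotZr k a b : vdot a (k *: b) = k * vdot a b.
Proof. by rewrite /vdot big_distrr/=; apply: eq_bigr => i _; rewrite mxE mulrCA. Qed.

Lemma vdotZl k a b : vdot (k *: a) b = k * vdot a b.
Proof. by rewrite vdotC vdotZr vdotC. Qed.

Lemma vdot0r a : vdot a 0 = 0.
Proof. by rewrite -(scale0r a) vdotZr mul0r. Qed.

Lemma vdotBr a b c : vdot a (b - c) = vdot a b - vdot a c.
Proof. by rewrite -scaleN1r vdotDr vdotZr mulN1r. Qed.

Lemma vdot_sumr (I : Type) (r : seq I) a (F : I -> 'rV[R]_d) :
  vdot a (\sum_(i <- r) F i) = \sum_(i <- r) vdot a (F i).
Proof.
by apply: (big_morph (vdot a)) => [b c|]; [exact: vdotDr | exact: vdot0r].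
Qed.

Lemma vdot_suml (I : Type) (r : seq I) a (F : I -> 'rV[R]_d) :
  vdot (\sum_(i <- r) F i) a = \sum_(i <- r) vdot (F i) a.
Proof. by rewrite vdotC vdot_sumr; apply: eq_bigr => i _; rewrite vdotC. Qed.

Lemma sqr_vdot_le a b : vdot a b ^+ 2 <= vnorm a ^+ 2 * vnorm b ^+ 2.
Proof. by rewrite !sqr_vnorm; exact: cauchy_schwarz_sum. Qed.

Lemma vdot_le_vnorm a b : vdot a b <= vnorm a * vnorm b.
Proof.
have m0 : 0 <= vnorm a * vnorm b by rewrite mulr_ge0 ?vnorm_ge0.
have [neg|pos] := leP (vdot a b) 0; first exact: le_trans m0.
by rewrite -(ler_pXn2r (n := 2)) ?nnegrE ?(ltW pos)// exprMn sqr_vdot_le.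
Qed.

Lemma vnormZ k a : vnorm (k *: a) = `|k| * vnorm a.
Proof.
apply/eqP; rewrite -(eqrXn2 (n := 2)) ?mulr_ge0 ?vnorm_ge0//.
by rewrite exprMn !sqr_vnorm vdotZl vdotZr real_normK ?num_real// mulrA.
Qed.

Lemma vnorm0 : vnorm (0 : 'rV[R]_d) = 0.
Proof. by rewrite -(scale0r (0 : 'rV[R]_d)) vnormZ normr0 mul0r. Qed.

Lemma vnormN a : vnorm (- a) = vnorm a.
Proof. by rewrite -scaleN1r vnormZ normrN1 mul1r. Qed.

Lemma sqr_vnormD a b :
  vnorm (a + b) ^+ 2 = vnorm a ^+ 2 + 2 * vdot a b + vnorm b ^+ 2.
Proof. by rewrite !sqr_vnorm vdotDl !vdotDr (vdotC b a); ring. Qed.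

Lemma vnormD_le a b : vnorm (a + b) <= vnorm a + vnorm b.
Proof.
rewrite -(ler_pXn2r (n := 2)) ?nnegrE ?addr_ge0 ?vnorm_ge0//.
by rewrite sqr_vnormD; have := vdot_le_vnorm a b; nra.
Qed.

Lemma vnorm_sum_le (I : Type) (r : seq I) (F : I -> 'rV[R]_d) :
  vnorm (\sum_(i <- r) F i) <= \sum_(i <- r) vnorm (F i).
Proof.
elim: r => [|i r IH]; first by rewrite !big_nil vnorm0.
by rewrite !big_cons (le_trans (vnormD_le _ _))// lerD2l.
Qed.

(** Testing the subgradient inequality at [x + g] gives [vnorm g ^+ 2 <= G * vnorm g]. *)
Lemma lipschitz_subgrad_le (G : R) l x g :
  0 <= G -> lipschitzf G l -> subgrad l x g -> vnorm g <= G.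
Proof.
move=> G0 lip sg; have := sg (x + g); have := lip (x + g) x.
rewrite (addrC x) addrK -sqr_vnorm => h1 h2.
have h3 := le_trans (ler_norm _) h1.
have [->//|n0] := eqVneq (vnorm g) 0.
have np : 0 < vnorm g by rewrite lt_def n0 vnorm_ge0.
rewrite -(ler_pM2r np) -expr2; lra.
Qed.

(** * Regret of a single FreeGrad copy *)

Definition freegrad_potential (eps G : R) (s : 'rV[R]_d) (v : R) : R :=
  eps * G ^+ 2 / Num.sqrt v *
    expR (vnorm s ^+ 2 / (2 * v + 2 * G * vnorm s)).

Lemma freegrad_potentialE (eps G : R) s v : 0 < G -> 0 < v ->
  freegrad_potential eps G s v =
  eps * G * unit_potential (v / G ^+ 2) (vnorm s / G).
Proof.
move=> G0 v0; have s0 := vnorm_ge0 s.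
have Gs : 0 <= G * vnorm s by rewrite mulr_ge0// ltW.
have sv : 0 < Num.sqrt v by rewrite sqrtr_gt0.
rewrite /freegrad_potential /unit_potential sqrtrM ?ltW// sqrtrV ?sqr_ge0//.
rewrite sqrtr_sqr gtr0_norm//.
have -> : (vnorm s / G) ^+ 2 / (2 * (v / G ^+ 2 + vnorm s / G)) =
  vnorm s ^+ 2 / (2 * v + 2 * G * vnorm s).
  by field; rewrite ?gt_eqF//; nra.
by field; rewrite !gt_eqF.
Qed.

(* [freegrad_pred] is minus the gradient of the potential in [s]. *)
Lemma freegrad_potential_step (eps G : R) s g v :
  0 <= eps -> 0 < G -> G ^+ 2 <= v -> vnorm g <= G ->
  freegrad_potential eps G (s + g) (v + vnorm g ^+ 2) <=
  freegrad_potential eps G s v - vdot g (freegrad_pred eps G s v).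
Proof.
move=> e0 G0 vG gG; have s0 := vnorm_ge0 s.
have G20 : 0 < G ^+ 2 by rewrite exprn_gt0.
have v0 : 0 < v by apply: lt_le_trans vG.
have Gs : 0 <= G * vnorm s by rewrite mulr_ge0// ltW.
have sv : 0 < Num.sqrt v by rewrite sqrtr_gt0.
rewrite /freegrad_pred vdotZr.
set lhs := freegrad_potential _ _ (s + g) _.
have -> : freegrad_potential eps G s v -
   - eps * ((2 * v + G * vnorm s) * G ^+ 2) /
   (2 * (v + G * vnorm s) ^+ 2 * Num.sqrt v) *
   expR (vnorm s ^+ 2 / (2 * v + 2 * G * vnorm s)) * vdot g s =
   freegrad_potential eps G s v *
   (1 + (2 * v + G * vnorm s) / (2 * (v + G * vnorm s) ^+ 2) * vdot g s).
  by rewrite /freegrad_potential; field; rewrite ?gt_eqF//; nra.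
rewrite /lhs !freegrad_potentialE//; last by rewrite ltr_wpDr// sqr_ge0.
rewrite -[leRHS]mulrA ler_wpM2l ?mulr_ge0 ?(ltW G0)//.
have -> : (2 * v + G * vnorm s) / (2 * (v + G * vnorm s) ^+ 2) * vdot g s =
  (2 * (v / G ^+ 2) + vnorm s / G) / (2 * (v / G ^+ 2 + vnorm s / G) ^+ 2) *
    (vdot s g / G ^+ 2).
  by rewrite (vdotC g s); field; rewrite ?gt_eqF//; nra.
rewrite mulrDl; apply: unit_potential_step.
- by rewrite ler_pdivlMr// mul1r.
- by rewrite divr_ge0// ltW.
- by rewrite divr_ge0 ?vnorm_ge0// ltW.
- by rewrite ler_pdivrMr// mul1r ler_pXn2r ?nnegrE ?vnorm_ge0// ltW.
- by rewrite expr_div_n sqr_vnormD; field; rewrite gt_eqF.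
- rewrite !expr_div_n mulrACA -invfM -expr2 ler_wpM2r ?sqr_vdot_le//.
  by rewrite invr_ge0 sqr_ge0.
Qed.

(** Telescopes [freegrad_potential_step]; the initial potential, at [s = 0] and [v = G ^+ 2], is
    [eps * G]. *)
Lemma freegrad_sum_le (eps G : R) (g : nat -> 'rV[R]_d) n :
  0 <= eps -> 0 < G -> (forall t, (t < n)%N -> vnorm (g t) <= G) ->
  \sum_(t < n) vdot (g t) (freegrad_pred eps G (\sum_(tau < t) g tau)
      (G ^+ 2 + \sum_(tau < t) vnorm (g tau) ^+ 2)) <=
  eps * G - freegrad_potential eps G (\sum_(tau < n) g tau)
     (G ^+ 2 + \sum_(tau < n) vnorm (g tau) ^+ 2).
Proof.
move=> e0 G0; elim: n => [_|n IH gG].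
  rewrite !big_ord0 /freegrad_potential vnorm0 expr0n/= mul0r expR0 mulr1 addr0.
  rewrite sqrtr_sqr gtr0_norm//.
  by rewrite le_eqVlt; apply/orP; left; apply/eqP; field; rewrite gt_eqF.
rewrite !big_ord_recr/=.
apply: (le_trans (lerD (IH _) (lexx _))) => [t tn|]; first by apply: gG; exact: ltnW.
rewrite addrA; set S := \sum_(tau < n) g tau; set W := G ^+ 2 + _.
have WG : G ^+ 2 <= W.
  by rewrite /W lerDl sumr_ge0// => i _; exact: sqr_ge0.
have := freegrad_potential_step S e0 G0 WG (gG n (ltnSn n)).
lra.
Qed.

(* If the exponent of the potential exceeds [L] the potential already pays for
   [vdot s u]; otherwise [vnorm s] is at most [4 * L * Num.sqrt v]. *)
Lemma freegrad_conjugate_le (eps G L : R) s u v :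
  0 <= eps -> 0 < G -> G ^+ 2 <= v -> 1 <= L ->
  vnorm u * vnorm s * Num.sqrt v <= eps * G ^+ 2 * expR L ->
  vnorm u * vnorm s - freegrad_potential eps G s v <=
  4 * L * (vnorm u * Num.sqrt v).
Proof.
move=> e0 G0 vG L1 hL; have s0 := vnorm_ge0 s; have u0 := vnorm_ge0 u.
have v0 : 0 < v by apply: lt_le_trans vG; rewrite exprn_gt0.
have Gs : 0 <= G * vnorm s by rewrite mulr_ge0// ltW.
set q := Num.sqrt v; have q0 : 0 < q by rewrite sqrtr_gt0.
have vE : v = q ^+ 2 by rewrite /q sqr_sqrtr// ltW.
have Gq : G <= q.
  by rewrite /q -(gtr0_norm G0) -sqrtr_sqr ler_wsqrtr.
have den0 : 0 < 2 * v + 2 * G * vnorm s by lra.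
have pot0 : 0 <= freegrad_potential eps G s v.
  rewrite /freegrad_potential mulr_ge0 ?expR_ge0// divr_ge0 ?sqrtr_ge0//.
  by rewrite mulr_ge0// sqr_ge0.
have [small|big] := leP (vnorm s) (4 * L * q).
  apply: (@le_trans _ _ (vnorm u * vnorm s)); first by rewrite gerBl.
  by rewrite [leRHS]mulrCA ler_wpM2l.
apply: (@le_trans _ _ 0); last by rewrite !mulr_ge0//; lra.
rewrite subr_le0 /freegrad_potential -/q mulrAC ler_pdivlMr//.
apply: le_trans hL _; apply: ler_wpM2l; first by rewrite mulr_ge0// sqr_ge0.
rewrite ler_expR ler_pdivlMr//.
(* Multiplied by [L], each half of the denominator is at most [2 * L * q * vnorm s], and twice that
   is at most [vnorm s ^+ 2] because [vnorm s > 4 * L * q]. *)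
have h1 : q <= vnorm s by nra.
have h2 : L * (2 * v) <= 2 * L * q * vnorm s.
  rewrite vE; have : q * q <= q * vnorm s by rewrite ler_wpM2l// ltW.
  nra.
have h3 : L * (2 * G * vnorm s) <= 2 * L * q * vnorm s.
  have : G * vnorm s <= q * vnorm s by rewrite ler_wpM2r.
  nra.
have h4 : 4 * L * q * vnorm s <= vnorm s ^+ 2.
  by rewrite expr2 ler_wpM2r// ltW.
lra.
Qed.

(** By Cauchy-Schwarz the regret is at most [eps * G] plus the excess of [vnorm u * vnorm (S n)]
    over the final potential, and [freegrad_conjugate_le] bounds this excess. *)
Lemma freegrad_regret_le (eps G L : R) (g : nat -> 'rV[R]_d) n u :
  0 <= eps -> 0 < G -> (forall t, (t < n)%N -> vnorm (g t) <= G) -> 1 <= L ->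
  let S t := \sum_(tau < t) g tau in
  let W t := G ^+ 2 + \sum_(tau < t) vnorm (g tau) ^+ 2 in
  vnorm u * vnorm (S n) * Num.sqrt (W n) <= eps * G ^+ 2 * expR L ->
  \sum_(t < n) vdot (g t) (freegrad_pred eps G (S t) (W t) - u) <=
  eps * G + 4 * L * (vnorm u * Num.sqrt (W n)).
Proof.
move=> e0 G0 gG L1 S W hL.
under eq_bigr do rewrite vdotBr.
rewrite sumrB -vdot_suml -/(S n).
have WG : G ^+ 2 <= W n.
  by rewrite /W lerDl sumr_ge0// => i _; exact: sqr_ge0.
have h1 := freegrad_sum_le e0 G0 gG.
have h2 := freegrad_conjugate_le e0 G0 WG L1 hL.
have h3 : - vdot (S n) u <= vnorm u * vnorm (S n).
  by rewrite mulrC -(vnormN u) -mulN1r -vdotZr scaleN1r vdot_le_vnorm.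
rewrite -/(S n) -/(W n) in h1; move: h1; rewrite -/(S _); lra.
Qed.

End Euclidean.

(** * Haar coefficients *)

Lemma sum_blocks (V : nmodType) (F : nat -> V) (n L : nat) :
  \sum_(l < L) \sum_(i < n) F (n * l + i)%N = \sum_(t < n * L) F t.
Proof.
elim: L => [|L IH]; first by rewrite muln0 !big_ord0.
by rewrite big_ord_recr/= IH mulnS addnC big_split_ord/=.
Qed.

Lemma big_haar_cols (V : nmodType) (m : nat) (F : option (nat * nat) -> V) :
  \sum_(c <- haar_cols m) F c =
  F None + \sum_(j < m) \sum_(l < 2 ^ (m - j.+1)) F (Some (j.+1, l.+1)).
Proof.
rewrite /haar_cols big_cons big_allpairs_dep; congr (_ + _).
rewrite (iotaDl 1 0 m) big_map -(big_mkord xpredT (fun j =>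
  \sum_(l < 2 ^ (m - j.+1)) F (Some (j.+1, l.+1)))) /index_iota subn0.
apply: eq_bigr => j _.
rewrite (iotaDl 1 0 (2 ^ _)) big_map -(big_mkord xpredT (fun l =>
  F (Some (j.+1, l.+1)))) /index_iota subn0.
by apply: eq_bigr => l _.
Qed.

Lemma mem_haar_cols (m : nat) (c : option (nat * nat)) :
  c \in haar_cols m ->
  c = None \/ exists j l, (j < m)%N /\ c = Some (j.+1, l.+1).
Proof.
rewrite inE => /predU1P[->|]; first by left.
move=> /allpairsPdep[j [l []]]; rewrite !mem_iota => /andP[j0 jm] /andP[l0 _] ->.
right; exists j.-1, l.-1; rewrite !prednK//; split => //; lia.
Qed.

(** With zero-based scale, location and time, the defining intervals become a Euclidean division:
    the quotient selects the block, the remainder its half. *)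
Lemma haarE (R : realType) (j l t : nat) :
  haar R (Some (j.+1, l.+1)) t.+1 =
  if (t %/ 2 ^ j.+1 == l)%N then (if (t %% 2 ^ j.+1 < 2 ^ j)%N then 1 else -1) else 0.
Proof.
rewrite /haar subn1/=.
have p0 : (0 < 2 ^ j.+1)%N by rewrite expn_gt0.
have pE : (2 ^ j.+1 = 2 * 2 ^ j)%N by rewrite expnS.
have tE := divn_eq t (2 ^ j.+1).
have rb := ltn_pmod t p0.
set q := (t %/ _)%N in tE *; set r := (t %% _)%N in tE rb *.
set N := (2 ^ j.+1)%N in p0 pE tE rb *; set h := (2 ^ j)%N in pE *.
rewrite tE; have [<-|ne] := eqVneq q l.
  have [rh|hr] := ltnP r h.
    by rewrite (_ : (_ < _ <= _)%N = true)//; apply/andP; split; nia.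
  rewrite (_ : (_ < _ <= _)%N = false); last by apply/negbTE; rewrite negb_and; nia.
  by rewrite (_ : (_ < _ <= _)%N = true)//; apply/andP; split; nia.
rewrite (_ : (_ < _ <= _)%N = false); last by apply/negbTE; rewrite negb_and; nia.
by rewrite (_ : (_ < _ <= _)%N = false)//; apply/negbTE; rewrite negb_and; nia.
Qed.

Lemma normr_haar_le1 (R : realType) c t : `|haar R c t| <= 1.
Proof.
case: c => [[j l]|]/=; last by rewrite normr1.
case: ifP => _; first by rewrite normr1.
by case: ifP => _; rewrite ?normrN ?normr1 ?normr0.
Qed.

Definition haar_support (m : nat) (c : option (nat * nat)) : nat :=
  if c is Some (j, _) then (2 ^ j)%N else (2 ^ m)%N.

Lemma sum_sqr_haar_le (R : realType) (m n : nat) c :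
  c \in haar_cols m -> (n <= 2 ^ m)%N ->
  \sum_(t < n) haar R c t.+1 ^+ 2 <= (haar_support m c)%:R.
Proof.
move=> /mem_haar_cols[->|[j [l [jm ->]]]] nm.
  by rewrite /= (eq_bigr (fun=> 1)) ?sumr_const ?card_ord ?ler_nat// => i _; rewrite expr1n.
rewrite [haar_support _ _]/=; set N := (2 ^ j.+1)%N.
have N0 : (0 < N)%N by rewrite expn_gt0.
pose F (t : nat) : R := (t %/ N == l)%N%:R.
rewrite (eq_bigr (fun t : 'I_n => F t)); last first.
  move=> t _; rewrite haarE /F -/N; case: ifP => _; last by rewrite expr0n.
  by case: ifP => _; rewrite ?sqrrN expr1n.
(* Lengthening the range to [N * n] makes it a union of whole blocks of length [N], at most one of
   which is block [l]. *)
have nN : (n <= N * n)%N by rewrite leq_pmull.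
apply: (@le_trans _ _ (\sum_(t < N * n) F t)).
  by rewrite -(subnKC nN) big_split_ord/= lerDl sumr_ge0// => t _; rewrite ler0n.
rewrite -sum_blocks.
rewrite (eq_bigr (fun q : 'I_n => N%:R * ((q : nat) == l)%:R)); last first.
  move=> q _; rewrite (eq_bigr (fun=> ((q : nat) == l)%:R)).
    by rewrite sumr_const card_ord mulr_natl.
  by move=> i _; rewrite /F mulnC divnMDl// divn_small// addn0.
rewrite -mulr_sumr ler_piMr ?ler0n// -natr_sum -[leRHS]/(1%:R) ler_nat.
suff -> : (\sum_(q < n) ((q : nat) == l) = (l < n))%N by case: (l < n)%N.
by elim: (n) => [|k IH]; rewrite ?big_ord0// big_ord_recr/= IH; lia.
Qed.

Section HaarCoefficients.
Variables (R : realType) (d : nat) (x : nat -> 'rV[R]_d).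

Definition block_avg (b n : nat) : 'rV[R]_d :=
  n%:R^-1 *: \sum_(i < n) x (b + i)%N.

(** For [j >= 1] this is the orthogonal projection coefficient, the inner product with the column
    divided by its squared norm. *)
Definition haar_coef (m : nat) (c : option (nat * nat)) : 'rV[R]_d :=
  if c is Some (j, l) then
    let b := (2 ^ j * (l - 1))%N in
    2^-1 *: (block_avg b (2 ^ j.-1) - block_avg (b + 2 ^ j.-1) (2 ^ j.-1))
  else block_avg 0 (2 ^ m).

Lemma block_avg_double (b n : nat) : (0 < n)%N ->
  block_avg b (2 * n) = 2^-1 *: (block_avg b n + block_avg (b + n) n).
Proof.
move=> n0; rewrite /block_avg mul2n -addnn big_split_ord/= -scalerDr scalerA.
congr (_ *: (_ + _)); last by apply: eq_bigr => i _; rewrite addnA.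
have np : 0 < n%:R :> R by rewrite ltr0n.
by rewrite natrD; field; rewrite -?mulr2n ?mulrn_eq0 ?gt_eqF//; lra.
Qed.

Definition dyadic_avg (j t : nat) : 'rV[R]_d :=
  block_avg (2 ^ j * (t %/ 2 ^ j)) (2 ^ j).

(** A parent average is the mean of its two child averages, so a child deviates from it by half the
    difference of the siblings, with a sign given by the half containing [t]. *)
Lemma haar_coef_dyadic_avg (m j t : nat) :
  haar R (Some (j.+1, (t %/ 2 ^ j.+1).+1)) t.+1 *:
    haar_coef m (Some (j.+1, (t %/ 2 ^ j.+1).+1)) =
  dyadic_avg j t - dyadic_avg j.+1 t.
Proof.
rewrite haarE eqxx /haar_coef /= subn1/= /dyadic_avg.
have p0 : (0 < 2 ^ j.+1)%N by rewrite expn_gt0.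
have h0 : (0 < 2 ^ j)%N by rewrite expn_gt0.
have pE : (2 ^ j.+1 = 2 * 2 ^ j)%N by rewrite expnS.
have tE := divn_eq t (2 ^ j.+1).
have rb := ltn_pmod t p0.
set q := (t %/ 2 ^ j.+1)%N in tE *; set r := (t %% _)%N in tE rb *.
set N := (2 ^ j.+1)%N in p0 pE tE rb *; set h := (2 ^ j)%N in h0 pE *.
set a1 := block_avg (N * q) h; set a2 := block_avg (N * q + h) h.
have -> : block_avg (N * q) N = 2^-1 *: (a1 + a2).
  by rewrite {2}pE block_avg_double.
have half (a b : 'rV[R]_d) : a - 2^-1 *: (a + b) = 2^-1 *: (a - b).
  by apply/rowP => i; rewrite !mxE; field.
have [rh|hr] := ltnP r h.
  have -> : (h * (t %/ h) = N * q)%N.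
    have -> : (t %/ h = 2 * q)%N.
      by rewrite tE pE (_ : q * (2 * h) = (2 * q) * h)%N ?divnMDl ?(divn_small rh) ?addn0//; lia.
    by rewrite pE; lia.
  by rewrite -/a1 scale1r half.
have -> : (h * (t %/ h) = N * q + h)%N.
  have -> : (t %/ h = 2 * q + 1)%N.
    have -> : t = ((2 * q + 1) * h + (r - h))%N by rewrite tE pE; lia.
    by rewrite divnMDl// divn_small ?addn0//; lia.
  by rewrite pE; lia.
by rewrite -/a2 scaleN1r (addrC a1 a2) half -scalerN opprB.
Qed.

(** Only one column per scale is nonzero at [t], and the increments telescope from the average over
    the full range, carried by the constant column, down to [x t] at scale 0. *)
Lemma haar_reconstruction (m t : nat) : (t < 2 ^ m)%N ->
  x t = \sum_(c <- haar_cols m) haar R c t.+1 *: haar_coef m c.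
Proof.
move=> tm; rewrite big_haar_cols.
rewrite (eq_bigr (fun j : 'I_m => dyadic_avg j t - dyadic_avg j.+1 t)); last first.
  move=> j _; rewrite -(haar_coef_dyadic_avg m).
  have qb : (t %/ 2 ^ j.+1 < 2 ^ (m - j.+1))%N.
    by rewrite ltn_divLR ?expn_gt0// -expnD subnK.
  rewrite (bigD1 (Ordinal qb))// big1 => [|l lq]; first exact: addr0.
  rewrite haarE ifN ?scale0r//; apply: contraNN lq => /eqP lq.
  by apply/eqP/val_inj.
rewrite -(big_mkord xpredT (fun j => dyadic_avg j t - dyadic_avg j.+1 t)).
rewrite -[X in _ + X]opprK -sumrN.
rewrite (eq_bigr (fun j => dyadic_avg j.+1 t - dyadic_avg j t)); last first.
  by move=> j _; rewrite opprB.
rewrite telescope_sumr// /= scale1r /dyadic_avg (divn_small tm) muln0 opprB addrC subrK.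
by rewrite expn0 divn1 mul1n /block_avg big_ord1 addn0 invr1 scale1r.
Qed.

Variable c0 : 'rV[R]_d.

Lemma block_avg_dist_le (b n : nat) : (0 < n)%N ->
  n%:R * vnorm (block_avg b n - c0) ^+ 2 <=
  \sum_(i < n) vnorm (x (b + i)%N - c0) ^+ 2.
Proof.
move=> n0; have np : 0 < n%:R :> R by rewrite ltr0n.
have -> : block_avg b n - c0 = n%:R^-1 *: \sum_(i < n) (x (b + i)%N - c0).
  rewrite sumrB sumr_const card_ord scalerBr; congr (_ - _).
  by rewrite -(scaler_nat n c0) scalerA mulVf ?gt_eqF// scale1r.
rewrite vnormZ exprMn real_normK ?num_real// exprVn mulrA.
have -> : n%:R * n%:R ^- 2 = n%:R^-1 :> R by field; rewrite gt_eqF.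
rewrite ler_pdivrMl//.
have h : vnorm (\sum_(i < n) (x (b + i)%N - c0)) ^+ 2 <=
    (\sum_(i < n) 1 * vnorm (x (b + i)%N - c0)) ^+ 2.
  under [X in _ <= X ^+ 2]eq_bigr do rewrite mul1r.
  rewrite ler_pXn2r ?nnegrE ?vnorm_ge0 ?vnorm_sum_le//.
  by rewrite sumr_ge0// => i _; exact: vnorm_ge0.
apply: le_trans h _; apply: le_trans (cauchy_schwarz_sum _ _ _) _.
by rewrite (eq_bigr (fun=> 1)) ?sumr_const ?card_ord// => i _; rewrite expr1n.
Qed.

(** The reference point [c0] cancels in the difference of the two averages; the parallelogram
    inequality and [block_avg_dist_le] do the rest. *)
Lemma sqr_haar_coef_le (m j l : nat) :
  (2 ^ j.+1)%:R * vnorm (haar_coef m (Some (j.+1, l.+1))) ^+ 2 <=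
  \sum_(i < 2 ^ j.+1) vnorm (x (2 ^ j.+1 * l + i)%N - c0) ^+ 2.
Proof.
rewrite /haar_coef/= subn1/= vnormZ exprMn real_normK ?num_real//.
set b := (2 ^ j.+1 * l)%N; have h0 : (0 < 2 ^ j)%N by rewrite expn_gt0.
have := block_avg_dist_le b h0; have := block_avg_dist_le (b + 2 ^ j) h0.
have NE : (2 ^ j.+1 = 2 ^ j + 2 ^ j)%N by rewrite expnS mul2n addnn.
rewrite NE big_split_ord/=.
under [X in _ -> _ -> _ <= _ + X]eq_bigr do rewrite addnA.
set p := block_avg b _; set q := block_avg _ _.
have -> : p - q = (p - c0) + - (q - c0) by apply/rowP => i; rewrite !mxE; ring.
set P := p - c0; set Q := q - c0 => h2 h1.
have par : vnorm (P - Q) ^+ 2 <= 2 * vnorm P ^+ 2 + 2 * vnorm Q ^+ 2.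
  have := sqr_vnormD P Q; have := sqr_vnormD P (- Q).
  have -> : vdot P (- Q) = - vdot P Q by rewrite -scaleN1r vdotZr mulN1r.
  rewrite vnormN; have := sqr_ge0 (vnorm (P + Q)); lra.
rewrite natrD; have h0' : 0 <= (2 ^ j)%:R :> R by rewrite ler0n.
have := ler_wpM2l h0' par; lra.
Qed.

(** The count includes the switch out of the block, so that the counts over the blocks of a scale
    add up to the count over the whole range. *)
Lemma haar_coef_eq0 (m j l : nat) :
  (\sum_(i < 2 ^ j.+1) (x (2 ^ j.+1 * l + i).+1 != x (2 ^ j.+1 * l + i)))%N = 0%N ->
  haar_coef m (Some (j.+1, l.+1)) = 0.
Proof.
set b := (2 ^ j.+1 * l)%N => /eqP; rewrite sum_nat_eq0 => /forallP xeq.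
have xb i : (i <= 2 ^ j.+1)%N -> x (b + i)%N = x b.
  elim: i => [|i IH] ib; first by rewrite addn0.
  rewrite addnS -(IH (ltnW ib)).
  by have := xeq (Ordinal ib); rewrite eqb0 negbK => /eqP.
have hp : (2 ^ j)%:R != 0 :> R by rewrite pnatr_eq0 -lt0n expn_gt0.
have avg k : (k <= 2 ^ j)%N -> block_avg (b + k) (2 ^ j) = x b.
  move=> kj; rewrite /block_avg (eq_bigr (fun=> x b)).
    by rewrite sumr_const card_ord -(scaler_nat (2 ^ j) (x b)) scalerA mulVf// scale1r.
  by move=> i _; rewrite -addnA xb// expnS; have := ltn_ord i; lia.
by rewrite /haar_coef/= subn1/= -/b -{1}(addn0 b) !avg// subrr scaler0.
Qed.

(** Either there is no switch and the coefficient vanishes, or the count is at least 1 and may be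
    inserted as a factor. *)
Lemma haar_coef_le (m j l : nat) :
  vnorm (haar_coef m (Some (j.+1, l.+1))) * Num.sqrt (2 ^ j.+1)%:R <=
  Num.sqrt ((\sum_(i < 2 ^ j.+1)
       (x (2 ^ j.+1 * l + i).+1 != x (2 ^ j.+1 * l + i)))%N%:R *
    (\sum_(i < 2 ^ j.+1) vnorm (x (2 ^ j.+1 * l + i)%N - c0) ^+ 2)).
Proof.
set K := (\sum_(i < _) (_ != _))%N.
have [K0|K0] := posnP K.
  by rewrite haar_coef_eq0// vnorm0 mul0r sqrtr_ge0.
rewrite -[X in X * _]ger0_norm ?vnorm_ge0// -sqrtr_sqr -sqrtrM ?sqr_ge0//.
rewrite ler_wsqrtr// mulrC; apply: le_trans (sqr_haar_coef_le _ _ _) _.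
rewrite ler_peMl ?ler1n// sumr_ge0// => i _; exact: sqr_ge0.
Qed.

(** The weights match the [Num.sqrt v] in the regret of each copy. The first two terms pay for the
    constant column, the last for the [m] scales. *)
Lemma sum_haar_coef_le (m : nat) :
  \sum_(c <- haar_cols m) vnorm (haar_coef m c) * Num.sqrt (haar_support m c)%:R <=
  vnorm c0 * Num.sqrt (2 ^ m)%:R +
  Num.sqrt (\sum_(t < 2 ^ m) vnorm (x t - c0) ^+ 2) +
  m%:R * Num.sqrt ((\sum_(t < 2 ^ m) (x t.+1 != x t))%N%:R *
                   \sum_(t < 2 ^ m) vnorm (x t - c0) ^+ 2).
Proof.
rewrite big_haar_cols lerD//.
  rewrite [haar_coef m None]/= [haar_support m None]/=.
  have n0 : (0 < 2 ^ m)%N by rewrite expn_gt0.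
  rewrite -(subrK c0 (block_avg _ _)) addrC.
  apply: (@le_trans _ _ ((vnorm c0 + vnorm (block_avg 0 (2 ^ m) - c0)) * Num.sqrt (2 ^ m)%:R)).
    by rewrite ler_wpM2r ?sqrtr_ge0// vnormD_le.
  rewrite mulrDl lerD2l -[X in X * _]ger0_norm ?vnorm_ge0// -sqrtr_sqr.
  by rewrite -sqrtrM ?sqr_ge0// ler_wsqrtr// mulrC block_avg_dist_le.
rewrite -[X in X%:R * _](card_ord m) -sumr_const mulr_suml ler_sum// => j _.
rewrite mul1r; apply: le_trans; first by apply: ler_sum => l _; exact: haar_coef_le.
apply: le_trans (sum_sqrtM_le _ _ _) _ => [l|l|].
- by rewrite ler0n.
- by rewrite sumr_ge0// => i _; exact: sqr_ge0.
have jE : (2 ^ j.+1 * 2 ^ (m - j.+1) = 2 ^ m)%N by rewrite -expnD subnKC.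
rewrite -natr_sum (sum_blocks (fun t => nat_of_bool (x t.+1 != x t))).
by rewrite (sum_blocks (fun t => vnorm (x t - c0) ^+ 2)) jE.
Qed.

Lemma vnorm_block_avg_le (U : R) (b n : nat) : (0 < n)%N ->
  (forall t, vnorm (x t) <= U) -> vnorm (block_avg b n) <= U.
Proof.
move=> n0 xU; have np : 0 < n%:R :> R by rewrite ltr0n.
rewrite /block_avg vnormZ ger0_norm ?invr_ge0 ?ler0n// ler_pdivrMl//.
apply: le_trans (vnorm_sum_le _ _) _.
apply: le_trans (ler_sum _ (fun i _ => xU _)) _.
by rewrite sumr_const card_ord mulr_natl.
Qed.

Lemma vnorm_haar_coef_le (U : R) (m : nat) c :
  (forall t, vnorm (x t) <= U) -> vnorm (haar_coef m c) <= U.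
Proof.
move=> xU; case: c => [[j l]|]/=; last by rewrite vnorm_block_avg_le ?expn_gt0.
rewrite vnormZ ger0_norm ?invr_ge0//.
set p := block_avg _ _; set q := block_avg _ _.
have pU : vnorm p <= U by rewrite vnorm_block_avg_le ?expn_gt0.
have qU : vnorm q <= U by rewrite vnorm_block_avg_le ?expn_gt0.
by have := vnormD_le p (- q); rewrite vnormN; lra.
Qed.

End HaarCoefficients.

(** * Regret of Haar OLR *)

Section FixedHorizon.
Variables (R : realType) (d : nat).

Definition haar_olr (G : R) (m : nat) (g : nat -> 'rV[R]_d) (t : nat) : 'rV[R]_d :=
  \sum_(c <- haar_cols m)
     haar R c t.+1 *:
       freegrad_pred (1 / (2 ^ m)%:R) G
         (\sum_(tau < t) haar R c tau.+1 *: g tau)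
         (G ^+ 2 + \sum_(tau < t) haar R c tau.+1 ^+ 2 * vnorm (g tau) ^+ 2).

Variables (G L U : R) (m n : nat) (g x : nat -> 'rV[R]_d).
Hypotheses (G_gt0 : 0 < G) (L_ge1 : 1 <= L) (n_le : (n <= 2 ^ m)%N).
Hypothesis g_le : forall t, (t < n)%N -> vnorm (g t) <= G.
Hypothesis x_le : forall t, vnorm (x t) <= U.
Hypothesis U_le : U * (2 ^ m)%:R ^+ 2 * (1 + (2 ^ m)%:R) <= expR L.

(** Rounds in which the column is zero act as zero gradients, so the copy's [v] grows only over the
    support; this yields the square root of [haar_support]. *)
Lemma haar_column_regret_le c : c \in haar_cols m ->
  \sum_(t < n) vdot (haar R c t.+1 *: g t)
     (freegrad_pred (1 / (2 ^ m)%:R) G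
         (\sum_(tau < t) haar R c tau.+1 *: g tau)
         (G ^+ 2 + \sum_(tau < t) haar R c tau.+1 ^+ 2 * vnorm (g tau) ^+ 2)
       - haar_coef x m c) <=
  G / (2 ^ m)%:R +
  8 * G * L * (vnorm (haar_coef x m c) * Num.sqrt (haar_support m c)%:R).
Proof.
move=> cm; pose gh t := haar R c t.+1 *: g t.
have N0 : 0 < (2 ^ m)%:R :> R by rewrite ltr0n expn_gt0.
have N1 : 1 <= (2 ^ m)%:R :> R by rewrite ler1n expn_gt0.
have nN : n%:R <= (2 ^ m)%:R :> R by rewrite ler_nat.
have S1 : 1 <= (haar_support m c)%:R :> R.
  by rewrite ler1n /haar_support; case: (c) => [[j l]|]; rewrite expn_gt0.
have G2 : 0 <= G ^+ 2 by exact: sqr_ge0.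
have ghE t : vnorm (gh t) ^+ 2 = haar R c t.+1 ^+ 2 * vnorm (g t) ^+ 2.
  by rewrite /gh vnormZ exprMn real_normK ?num_real.
have h_sq t : haar R c t ^+ 2 <= 1.
  by rewrite -real_normK ?num_real// exprn_ile1 ?normr_haar_le1.
have gh_le t : (t < n)%N -> vnorm (gh t) <= G.
  move=> tn; rewrite /gh vnormZ -[leRHS]mul1r.
  by rewrite ler_pM ?normr_haar_le1 ?g_le ?vnorm_ge0.
have g_sq t : (t < n)%N -> vnorm (g t) ^+ 2 <= G ^+ 2.
  by move=> tn; rewrite ler_pXn2r ?nnegrE ?vnorm_ge0 ?g_le// ltW.
have WE k : G ^+ 2 + \sum_(tau < k) vnorm (gh tau) ^+ 2 =
    G ^+ 2 + \sum_(tau < k) haar R c tau.+1 ^+ 2 * vnorm (g tau) ^+ 2.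
  by congr (_ + _); apply: eq_bigr => i _; exact: ghE.
have := @freegrad_regret_le R d (1 / (2 ^ m)%:R) G L gh n (haar_coef x m c).
move=> /(_ _ G_gt0 gh_le L_ge1) /=.
under [X in _ -> _ -> X <= _]eq_bigr do rewrite WE.
rewrite WE; set W := G ^+ 2 + _.
have W_supp : Num.sqrt W <= 2 * G * Num.sqrt (haar_support m c)%:R.
  have -> : 2 * G * Num.sqrt (haar_support m c)%:R =
      Num.sqrt ((2 * G) ^+ 2 * (haar_support m c)%:R).
    by rewrite sqrtrM ?sqr_ge0// sqrtr_sqr ger0_norm// mulr_ge0// ltW.
  rewrite ler_wsqrtr// /W.
  have : \sum_(tau < n) haar R c tau.+1 ^+ 2 * vnorm (g tau) ^+ 2 <=
      G ^+ 2 * (haar_support m c)%:R.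
    apply: (@le_trans _ _ (G ^+ 2 * \sum_(tau < n) haar R c tau.+1 ^+ 2)).
      rewrite mulr_sumr ler_sum// => t _; rewrite mulrC ler_wpM2r ?sqr_ge0 ?g_sq//.
    by rewrite ler_wpM2l// sum_sqr_haar_le.
  have : G ^+ 2 <= G ^+ 2 * (haar_support m c)%:R by rewrite ler_peMr.
  rewrite exprMn; lra.
(* This bound and [S_N] are cruder and serve only the side condition on [L], which [U_le] matches
   for [eps = 1 / 2 ^ m]. *)
have W_N : Num.sqrt W <= G * (1 + (2 ^ m)%:R).
  rewrite -[leRHS]ger0_norm; last by rewrite mulr_ge0 ?addr_ge0 ?(ltW G_gt0) ?ler0n.
  rewrite -sqrtr_sqr ler_wsqrtr// exprMn /W.
  have : \sum_(tau < n) haar R c tau.+1 ^+ 2 * vnorm (g tau) ^+ 2 <= G ^+ 2 * n%:R.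
    rewrite mulr_natr -[in leRHS](card_ord n) -sumr_const ler_sum// => t _.
    by rewrite -[leRHS]mul1r ler_pM ?sqr_ge0 ?g_sq.
  have : G ^+ 2 * n%:R <= G ^+ 2 * (2 ^ m)%:R by rewrite ler_wpM2l.
  have : 0 <= G ^+ 2 * (2 ^ m)%:R by rewrite mulr_ge0// ltW.
  have : 0 <= G ^+ 2 * (2 ^ m)%:R ^+ 2 by rewrite mulr_ge0// sqr_ge0.
  rewrite sqrrD expr1n mul1r; lra.
have S_N : vnorm (\sum_(tau < n) gh tau) <= G * (2 ^ m)%:R.
  apply: le_trans (vnorm_sum_le _ _) _.
  apply: (@le_trans _ _ (G * n%:R)); last by rewrite ler_wpM2l// ltW.
  by rewrite mulr_natr -[in leRHS](card_ord n) -sumr_const ler_sum// => t _; exact: gh_le.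
have u_U : vnorm (haar_coef x m c) <= U by exact: vnorm_haar_coef_le.
set u := haar_coef x m c in u_U *.
move=> fg; apply: (le_trans (fg _ _)).
- by rewrite divr_ge0// ltW.
- apply: (@le_trans _ _ (U * (G * (2 ^ m)%:R) * (G * (1 + (2 ^ m)%:R)))).
    by rewrite !ler_pM ?mulr_ge0 ?vnorm_ge0 ?sqrtr_ge0.
  have -> : U * (G * (2 ^ m)%:R) * (G * (1 + (2 ^ m)%:R)) =
    1 / (2 ^ m)%:R * G ^+ 2 * (U * (2 ^ m)%:R ^+ 2 * (1 + (2 ^ m)%:R)).
    by field; rewrite gt_eqF.
  by apply: ler_wpM2l => //; rewrite mulr_ge0// divr_ge0// ltW.
- have -> : 1 / (2 ^ m)%:R * G = G / (2 ^ m)%:R by field; rewrite gt_eqF.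
  rewrite lerD2l.
  apply: (@le_trans _ _ (4 * L * (vnorm u * (2 * G * Num.sqrt (haar_support m c)%:R)))).
    apply: ler_wpM2l; first by have := L_ge1; lra.
    by apply: ler_wpM2l => //; exact: vnorm_ge0.
  by rewrite le_eqVlt; apply/orP; left; apply/eqP; ring.
Qed.

(** Prediction and comparator are expanded in the same columns, so the linear regret splits into one
    regret per copy, even when the epoch stops at [n < 2 ^ m]. *)
Lemma haar_olr_regret_le (c0 : 'rV[R]_d) :
  \sum_(t < n) vdot (g t) (haar_olr G m g t - x t) <=
  G * (1 + m%:R) + 8 * G * L *
  (vnorm c0 * Num.sqrt (2 ^ m)%:R +
   Num.sqrt (\sum_(t < 2 ^ m) vnorm (x t - c0) ^+ 2) +
   m%:R * Num.sqrt ((\sum_(t < 2 ^ m) (x t.+1 != x t))%N%:R *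
                   \sum_(t < 2 ^ m) vnorm (x t - c0) ^+ 2)).
Proof.
have N0 : 0 < (2 ^ m)%:R :> R by rewrite ltr0n expn_gt0.
rewrite (eq_bigr (fun t : 'I_n => \sum_(c <- haar_cols m)
  vdot (haar R c t.+1 *: g t)
     (freegrad_pred (1 / (2 ^ m)%:R) G
         (\sum_(tau < t) haar R c tau.+1 *: g tau)
         (G ^+ 2 + \sum_(tau < t) haar R c tau.+1 ^+ 2 * vnorm (g tau) ^+ 2)
       - haar_coef x m c))); last first.
  move=> t _; rewrite (haar_reconstruction x (leq_trans (ltn_ord t) n_le)).
  rewrite /haar_olr -sumrB vdot_sumr; apply: eq_bigr => c _.
  by rewrite -scalerBr vdotZr vdotZl.
rewrite exchange_big/= big_seq.
apply: le_trans (ler_sum _ (fun c cm => haar_column_regret_le cm)) _.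
rewrite -big_seq big_split/= lerD//.
  (* Each column costs [G / 2 ^ m] and each scale has at most [2 ^ m] columns, hence at most [G] per
     scale and for the constant column. *)
  rewrite big_haar_cols mulrDr mulr1 lerD//.
    by rewrite ler_pdivrMr// ler_peMr ?ler1n ?expn_gt0// ltW.
  rewrite mulr_natr -[in leRHS](card_ord m) -sumr_const ler_sum// => j _.
  rewrite sumr_const card_ord -[leLHS]mulr_natr mulrAC ler_pdivrMr// ler_wpM2l ?(ltW G_gt0)//.
  by rewrite ler_nat leq_exp2l// leq_subr.
rewrite -mulr_sumr; apply: ler_wpM2l; last exact: sum_haar_coef_le.
by rewrite !mulr_ge0 ?(ltW G_gt0)// (le_trans ler01).
Qed.

End FixedHorizon.

(** * Splitting the anytime run into epochs *)

Section Anytime.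
Variables (R : realType) (d : nat) (G : R) (env : environment R d).

Lemma history_grads n : (history G env n).2 = mkseq (grad G env) n.
Proof. by elim: n => // n IH; rewrite mkseqS /= -IH. Qed.

(** Even against an adaptive environment the realised gradients form one sequence, and each epoch is
    a fresh fixed-horizon run on its own stretch of it. *)
Lemma play_epoch m t : (0 < m)%N -> (t < 2 ^ m)%N ->
  play G env (2 ^ m - 2 + t) =
  haar_olr G m (fun tau => grad G env (2 ^ m - 2 + tau)) t.
Proof.
move=> m0 tm; rewrite /play /= last_rcons history_grads /anytime_haar size_mkseq.
have m2 : (2 <= 2 ^ m)%N by rewrite -{1}(expn1 2) leq_exp2l.
have -> : trunc_log 2 (2 ^ m - 2 + t).+2 = m.
  by apply: trunc_log_eq => //; rewrite expnS; lia.
rewrite addKn /haar_olr; apply: eq_bigr => c _.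
have gE (tau : 'I_t) : nth 0 (mkseq (grad G env) (2 ^ m - 2 + t)) (2 ^ m - 2 + tau)
    = grad G env (2 ^ m - 2 + tau) by rewrite nth_mkseq// ltn_add2l.
under eq_bigr do rewrite gE.
rewrite [in LHS](eq_bigr (fun tau : 'I_t =>
  haar R c tau.+1 ^+ 2 * vnorm (grad G env (2 ^ m - 2 + tau)) ^+ 2))// => tau _.
by rewrite gE.
Qed.

(* Epoch [m >= 1] consists of the rounds [2 ^ m - 2 + tau] with
   [tau < 2 ^ m]; only the last one may be incomplete. *)
Lemma sum_epochs_le (F : nat -> R) (B : R) (T M : nat) : 0 <= B ->
  (forall m n, (0 < m)%N -> (0 < n <= 2 ^ m)%N -> (2 ^ m - 2 + n <= T)%N ->
    \sum_(t < n) F (2 ^ m - 2 + t)%N <= B) ->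
  (T <= 2 ^ M.+1 - 2)%N -> \sum_(t < T) F t <= M%:R * B.
Proof.
move=> B0; elim: M T => [|M IH] T FB TM.
  by move: TM; rewrite expn1 subnn leqn0 => /eqP ->; rewrite big_ord0 mul0r.
have [small|big] := leqP T (2 ^ M.+1 - 2).
  apply: le_trans (IH _ FB small) _.
  by rewrite ler_wpM2r// ler_nat.
have TE : T = (2 ^ M.+1 - 2 + (T - (2 ^ M.+1 - 2)))%N by rewrite subnKC// ltnW.
rewrite TE big_split_ord/= -natr1 mulrDl mul1r lerD//.
  apply: IH => // m n m0 nm mn; apply: FB => //.
  by apply: leq_trans mn _; exact: ltnW.
apply: FB => //; last by rewrite -TE.
rewrite subn_gt0 big/=; move: TM; rewrite (expnS 2 M.+1).
have m2 : (2 <= 2 ^ M.+1)%N by rewrite -{1}(expn1 2) leq_exp2l.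
by lia.
Qed.

End Anytime.

(** * The comparator beyond the horizon *)

Lemma sum_shift_le (R : numDomainType) (F : nat -> R) (T s n : nat) :
  (forall t, 0 <= F t) -> (forall t, (T <= t)%N -> F t = 0) ->
  \sum_(t < n) F (s + t)%N <= \sum_(t < T) F t.
Proof.
move=> F0 FT; apply: (@le_trans _ _ (\sum_(t < s + n) F t)).
  by rewrite big_split_ord/= lerDr sumr_ge0.
apply: (@le_trans _ _ (\sum_(t < s + n + T) F t)).
  by rewrite [leRHS]big_split_ord/= lerDl sumr_ge0.
rewrite addnC big_split_ord/= [X in _ + X]big1 ?addr0// => i _.
by rewrite FT// leq_addr.
Qed.

Section Comparator.
Variables (R : realType) (d : nat) (u : nat -> 'rV[R]_d) (T : nat).
Hypothesis T_gt0 : (0 < T)%N.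

(* Beyond the horizon the comparator is continued by its mean, which costs at
   most one switch and no deviation. *)
Definition extend_comparator (t : nat) : 'rV[R]_d :=
  if (t < T)%N then u t else ubar u T.

Lemma vnorm_le_umax t : (t < T)%N -> vnorm (u t) <= umax u T.
Proof.
by move=> tT; have := le_bigmax 0 (fun i : 'I_T => vnorm (u i)) (Ordinal tT).
Qed.

Lemma umax_ge0 : 0 <= umax u T.
Proof. exact: le_trans (vnorm_ge0 _) (vnorm_le_umax T_gt0). Qed.

Lemma vnorm_ubar_le : vnorm (ubar u T) <= umax u T.
Proof.
have Tp : 0 < T%:R :> R by rewrite ltr0n.
rewrite /ubar vnormZ ger0_norm ?invr_ge0 ?ler0n// ler_pdivrMl//.
apply: le_trans (vnorm_sum_le _ _) _.
rewrite mulr_natl -[X in _ *+ X](card_ord T) -sumr_const ler_sum// => t _.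
exact: vnorm_le_umax.
Qed.

Lemma vnorm_extend_le t : vnorm (extend_comparator t) <= umax u T.
Proof.
by rewrite /extend_comparator; case: ifP => [/vnorm_le_umax|_] //; exact: vnorm_ubar_le.
Qed.

Lemma extend_deviation_le s n :
  \sum_(t < n) vnorm (extend_comparator (s + t) - ubar u T) ^+ 2 <= Ebar u T.
Proof.
have -> : Ebar u T = \sum_(t < T) vnorm (extend_comparator t - ubar u T) ^+ 2.
  by apply: eq_bigr => t _; rewrite /extend_comparator ltn_ord.
apply: (sum_shift_le (F := fun t => vnorm (extend_comparator t - ubar u T) ^+ 2)) => t.
  exact: sqr_ge0.
by move=> Tt; rewrite /extend_comparator ltnNge Tt/= subrr vnorm0 expr0n.
Qed.

Lemma extend_switches_le s n :
  (\sum_(t < n) (extend_comparator (s + t).+1 != extend_comparator (s + t)))%N%:R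
    <= (switches u T)%:R + 1 :> R.
Proof.
pose F t : R := (extend_comparator t.+1 != extend_comparator t)%:R.
rewrite natr_sum.
apply: le_trans (sum_shift_le (F := F) (T := T) s n _ _) _ => [t|t Tt|].
- by rewrite ler0n.
- by rewrite /F /extend_comparator !ltnNge Tt (leq_trans Tt)//= eqxx.
(* The last term, at time [T.-1], is the possible switch into the mean. *)
rewrite -(prednK T_gt0) big_ord_recr/= lerD//; last by rewrite /F lern1 leq_b1.
rewrite /switches natr_sum ler_sum// => t _; rewrite /F /extend_comparator.
have tT : (t.+1 < T)%N by rewrite -ltn_predRL ltn_ord.
by rewrite tT (ltnW tT).
Qed.

Lemma Ebar_eq0 : switches u T = 0%N -> Ebar u T = 0.
Proof.
move=> /eqP; rewrite /switches sum_nat_eq0 => /forallP sw.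
have Tp : 0 < T%:R :> R by rewrite ltr0n.
have u0 t : (t < T)%N -> u t = u 0%N.
  elim: t => // t IH tT; rewrite -(IH (ltnW tT)).
  have tT' : (t < T.-1)%N by rewrite ltn_predRL.
  by have := sw (Ordinal tT'); rewrite eqb0 negbK => /eqP.
have ub : ubar u T = u 0%N.
  rewrite /ubar (eq_bigr (fun=> u 0%N)) => [|i _]; last exact: u0.
  by rewrite sumr_const card_ord -(scaler_nat T (u 0%N)) scalerA mulVf ?gt_eqF// scale1r.
rewrite /Ebar big1// => i _; by rewrite ub u0// subrr vnorm0 expr0n.
Qed.

(** Absorbs the extra switch: without switches both sides vanish, otherwise [K + 1 <= 4 * K]. *)
Lemma sqrt_switches_succ_le :
  Num.sqrt (((switches u T)%:R + 1) * Ebar u T) <=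
  2 * Num.sqrt ((switches u T)%:R * Ebar u T).
Proof.
have E0 : 0 <= Ebar u T by rewrite sumr_ge0// => i _; exact: sqr_ge0.
have [K0|K0] := posnP (switches u T).
  by rewrite (Ebar_eq0 K0) !mulr0 sqrtr0 mulr0.
have K1 : 1 <= (switches u T)%:R :> R by rewrite ler1n.
have -> : 2 * Num.sqrt ((switches u T)%:R * Ebar u T) =
    Num.sqrt (2 ^+ 2 * ((switches u T)%:R * Ebar u T)).
  by rewrite [RHS]sqrtrM ?sqr_ge0// sqrtr_sqr ger0_norm.
by rewrite ler_wsqrtr// mulrA ler_wpM2r//; lra.
Qed.

End Comparator.

(** * Assembling the switching regret bound *)

Lemma natr_le_ln_exp2 (R : realType) (m : nat) : m%:R <= 2 * ln (2 ^ m)%:R :> R.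
Proof.
(* At [x = 2 / 3] the Pade exponent is exactly [1 / 2], whence [expR (1 / 2) <= 5 / 3 < 2]. *)
have x0 : 0 <= 2 / 3 :> R by rewrite divr_ge0.
have h : 2^-1 <= ln 2 :> R.
  rewrite -ler_expR lnK ?posrE//.
  have -> : 2^-1 = 2 * (2 / 3) / (2 + 2 / 3) :> R by field; lra.
  by apply: le_trans (expR_le_1D x0) _; lra.
by rewrite natrX lnXn// -[ln 2 *+ m]mulr_natl mulrCA ler_peMr ?ler0n//; lra.
Qed.

Theorem theorem2 (R : realType) (G : R) :
  0 < G ->
  exists (C : R) (k : nat), 0 < C /\
  forall (d : nat) (T : nat) (env : environment R d) (u : nat -> 'rV[R]_d),
    (0 < d)%N -> (0 < T)%N ->
    admissible G env T ->
    regret G env u T <=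
      C * (1 + ln (1 + T%:R) + ln (1 + umax u T)) ^+ k *
      (1 + vnorm (ubar u T) * Num.sqrt T%:R
         + Num.sqrt ((switches u T)%:R * Ebar u T)).
Proof.
move=> G0; exists (400 * G), 3%N; split; first by rewrite mulr_gt0 ?ltr0n.
move=> d T env u _ T0 adm.
set U := umax u T; set K := (switches u T)%:R; set E := Ebar u T.
set a := vnorm _ * _; set b := Num.sqrt (K * E).
set Lam := 1 + ln _ + ln _.
have U0 : 0 <= U by exact: umax_ge0.
have T1 : 1 <= T%:R :> R by rewrite ler1n.
have E0 : 0 <= E by rewrite sumr_ge0// => i _; exact: sqr_ge0.
have K0 : 0 <= K by rewrite ler0n.
have lnT : 0 <= ln (1 + T%:R) :> R by rewrite ln_ge0//; lra.
have lnU : 0 <= ln (1 + U) by rewrite ln_ge0//; lra.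
have Lam1 : 1 <= Lam by rewrite /Lam; lra.
have a0 : 0 <= a by rewrite mulr_ge0 ?vnorm_ge0 ?sqrtr_ge0.
have b0 : 0 <= b by exact: sqrtr_ge0.
have expLam : (1 + T%:R) * (1 + U) <= expR Lam.
  rewrite /Lam !expRD !lnK ?posrE; [|lra|lra].
  have e1 : 1 <= expR 1 :> R by apply: le_trans (expR_ge1Dx 1); lra.
  by rewrite -[leRHS]mulrA ler_peMl// mulr_ge0//; lra.
have m_le m : (2 ^ m <= T.+1)%N -> m%:R <= 2 * Lam.
  move=> mT; apply: le_trans (natr_le_ln_exp2 _ m) _; rewrite ler_wpM2l//.
  apply: (@le_trans _ _ (ln (1 + T%:R))); last by rewrite /Lam; lra.
  by rewrite nat1r ler_ln ?posrE ?ltr0n ?expn_gt0// ler_nat.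
pose x := extend_comparator u T.
pose F t := vdot (grad G env t) (play G env t - x t).
set B := 200 * G * Lam ^+ 2 * (1 + a + b).
have B0 : 0 <= B by rewrite /B !mulr_ge0 ?sqr_ge0//; lra.
apply: (@le_trans _ _ (\sum_(t < T) F t)).
  apply: ler_sum => t _; have [_ _ sg] := adm t (ltn_ord t).
  have := sg (u t); rewrite /F /x /extend_comparator ltn_ord.
  by rewrite !vdotBr; lra.
have M_le : (trunc_log 2 T.+1)%:R <= 2 * Lam by apply: m_le; exact: trunc_logP.
have TM : (T <= 2 ^ (trunc_log 2 T.+1).+1 - 2)%N.
  by move: (@trunc_log_ltn 2 T.+1 isT); clear; lia.
apply: (@le_trans _ _ (2 * Lam * B)); last first.
  by rewrite /B le_eqVlt; apply/orP; left; apply/eqP; ring.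
apply: le_trans (_ : (trunc_log 2 T.+1)%:R * B <= _); last by rewrite ler_wpM2r.
apply: sum_epochs_le => // m n m0 /andP[n0 nm] mnT.
have m2 : (2 <= 2 ^ m)%N by rewrite -{1}(expn1 2) leq_exp2l.
(* An epoch in which at least one round is played satisfies [2 ^ m <= T + 1], even if it is
   incomplete. *)
have NT : (2 ^ m <= T.+1)%N by move: m2 n0 mnT; clear; lia.
have NTr : (2 ^ m)%:R <= 1 + T%:R :> R by rewrite nat1r ler_nat.
have mL := m_le m NT.
pose g t := grad G env (2 ^ m - 2 + t); pose y t := x (2 ^ m - 2 + t)%N.
have -> : \sum_(t < n) F (2 ^ m - 2 + t)%N =
    \sum_(t < n) vdot (g t) (haar_olr G m g t - y t).
  by apply: eq_bigr => t _; rewrite /F play_epoch// (leq_trans (ltn_ord t)).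
have g_le t : (t < n)%N -> vnorm (g t) <= G.
  move=> tn; have [|_ lip sg] := adm (2 ^ m - 2 + t)%N.
    by apply: leq_trans mnT; rewrite ltn_add2l.
  exact: lipschitz_subgrad_le (ltW G0) lip sg.
have y_le t : vnorm (y t) <= U by exact: vnorm_extend_le.
(* Since [2 ^ m <= 1 + T], the square and the factor [1 + 2 ^ m] are each at most [(1 + T) ^+ 2], so
   [L = 4 * Lam] suffices. *)
have U_le : U * (2 ^ m)%:R ^+ 2 * (1 + (2 ^ m)%:R) <= expR (4 * Lam).
  have N0 : 0 <= (2 ^ m)%:R :> R by rewrite ler0n.
  apply: (@le_trans _ _ (((1 + T%:R) * (1 + U)) ^+ 4)); last first.
    by rewrite (expRM_natl 4 Lam) ler_pXn2r ?nnegrE ?expR_ge0// mulr_ge0//; lra.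
  apply: (@le_trans _ _ ((1 + U) * (1 + T%:R) ^+ 2 * (1 + T%:R) ^+ 2)).
    rewrite ler_pM ?mulr_ge0 ?sqr_ge0 ?addr_ge0//.
      by rewrite ler_pM ?sqr_ge0 ?ler_pXn2r ?nnegrE ?addr_ge0 ?ler0n//; lra.
    nra.
  rewrite exprMn -mulrA -exprD mulrC ler_wpM2l ?exprn_ge0 ?addr_ge0 ?ler0n//.
  by rewrite ler_eXnr//; lra.
have L1 : 1 <= 4 * Lam by lra.
apply: le_trans (haar_olr_regret_le G0 L1 nm g_le y_le U_le (ubar u T)) _.
set Em := \sum_(t < 2 ^ m) _; set Km := (\sum_(t < 2 ^ m) _)%N%:R.
have EmE : Em <= E by exact: extend_deviation_le.
have Em0 : 0 <= Em by rewrite sumr_ge0// => i _; exact: sqr_ge0.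
have KmK : Km <= K + 1.
  apply: le_trans (extend_switches_le u T0 (2 ^ m - 2) (2 ^ m)).
  by rewrite /Km /y /x ler_nat leq_sum// => i _; rewrite addnS.
have sKE := sqrt_switches_succ_le u T0; rewrite -/K -/E -/b in sKE.
have hE : Num.sqrt Em <= 2 * b.
  apply: le_trans sKE; rewrite ler_wsqrtr// (le_trans EmE)// ler_peMl//; lra.
have hKE : Num.sqrt (Km * Em) <= 2 * b.
  by apply: le_trans sKE; rewrite ler_wsqrtr// ler_pM// ler0n.
have ha : vnorm (ubar u T) * Num.sqrt (2 ^ m)%:R <= 2 * a.
  rewrite /a mulrCA ler_wpM2l ?vnorm_ge0//.
  have -> : 2 * Num.sqrt T%:R = Num.sqrt (2 ^+ 2 * T%:R) :> R.
    by rewrite sqrtrM ?sqr_ge0// sqrtr_sqr ger0_norm.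
  by rewrite ler_wsqrtr//; lra.
have hmKE : m%:R * Num.sqrt (Km * Em) <= 2 * Lam * (2 * b).
  by rewrite ler_pM ?ler0n ?sqrtr_ge0.
apply: (@le_trans _ _ (G * (1 + 2 * Lam) +
    8 * G * (4 * Lam) * (2 * a + 2 * b + 2 * Lam * (2 * b)))).
  rewrite lerD// ler_wpM2l//; [lra|lra| |by rewrite !lerD].
  by rewrite !mulr_ge0//; lra.
have -> : B = G * (Lam * (Lam * (200 * (1 + a + b)))) by rewrite /B; ring.
have -> : G * (1 + 2 * Lam) + 8 * G * (4 * Lam) * (2 * a + 2 * b + 2 * Lam * (2 * b)) =
  G * (1 + 2 * Lam + Lam * (32 * (2 * a + 2 * b + 4 * (Lam * b)))) by ring.
rewrite ler_wpM2l ?(ltW G0)//.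
(* With [Lam >= 1], the coefficient of [Lam * b] totals 64 + 128 = 192, which the constant 200 in
   [B] covers. *)
have La : a <= Lam * a by rewrite ler_peMl.
have Lb : b <= Lam * b by rewrite ler_peMl.
apply: (@le_trans _ _ (Lam * (3 + 32 * (2 * a + 2 * b + 4 * (Lam * b))))); first lra.
rewrite ler_wpM2l//; first lra.
lra.
Qed.
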